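(* Let $(V_1,\nu_1,\tau,\tau^* )$ and $(V_2,\nu_2,\tau,\tau^* )$ be two PN spaces under the same triangle functions $\tau$ and $\tau^*$, and let $\tau_1$ be a triangle function. Assume that $\tau^*\gg\tau_1$ and $\tau_1\gg\tau$. Then the $\tau_1$-product $(V_1\times V_2,\nu^{\tau_1})$, where $\nu^{\tau_1}(p,q):=\tau_1(\nu_1(p),\nu_2(q))$ for $(p,q)\in V_1\times V_2$, is a PN space under $\tau$ and $\tau^*$, i.e. $(V_1\times V_2,\nu^{\tau_1},\tau,\tau^* )$ is a PN space.
   Context: $\Delta^+$ is the set of distance distribution functions: nondecreasing $F:[0,+\infty]\to[0,1]$ with $F(0)=0$, $F(+\infty)=1$, left-continuous on $(0,+\infty)$; it is ordered pointwise and endowed with the topology of weak convergence. For $0\le a<+\infty$, $\epsilon_a(x)=0$ for $x\le a$ and $\epsilon_a(x)=1$ for $x>a$; $\epsilon_{+\infty}(x)=0$ for $x<+\infty$ and $\epsilon_{+\infty}(+\infty)=1$. A triangle function is a binary operation on $\Delta^+$ that is commutative, associative, nondecreasing in each argument and has $\epsilon_0$ as identity; continuity of a triangle function refers to the topology of weak convergence. A PN (probabilistic normed) space is a quadruple $(V,\nu,\tau,\tau^* )$ where $V$ is a real linear space with null vector $\theta$, $\tau,\tau^*$ are continuous triangle functions with $\tau\le\tau^*$, and $\nu:V\to\Delta^+$, $p\mapsto\nu_p=\nu(p)$, satisfies: (N1) $\nu_p=\epsilon_0$ iff $p=\theta$; (N2) $\nu_{-p}=\nu_p$ for all $p\in V$;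 (N3) $\nu_{p+q}\ge\tau(\nu_p,\nu_q)$ for all $p,q\in V$; (N4) $\nu_p\le\tau^*(\nu_{\alpha p},\nu_{(1-\alpha)p})$ for all $\alpha\in[0,1]$ and $p\in V$. For triangle functions, $\sigma_1$ dominates $\sigma_2$, written $\sigma_1\gg\sigma_2$, if for all $F_1,F_2,G_1,G_2\in\Delta^+$: $\sigma_1(\sigma_2(F_1,G_1),\sigma_2(F_2,G_2))\ge\sigma_2(\sigma_1(F_1,F_2),\sigma_1(G_1,G_2))$. *)

(* Defs.v *)
From HB Require Import structures.
From mathcomp Require Import all_boot all_order all_algebra.
From mathcomp Require Import all_classical all_reals all_analysis.
From mathcomp Require Import lra.

Set Implicit Arguments.
Unset Strict Implicit.
Unset Printing Implicit Defensive.

Import Order.TTheory GRing.Theory Num.Theory.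
Import numFieldNormedType.Exports.

Local Open Scope classical_set_scope.
Local Open Scope ring_scope.

(* The values of [F : [0, +oo] -> R] at finite points, as a function on the
   whole real line.  The absolute value only serves to land in [0, +oo[: this
   function is used near points x > 0, where it agrees with F. *)
Definition on_real (R : realType) (F : {nonneg \bar R} -> R) (x : R) : R :=
  F (`|x|%:E)%:nng%E.

Record ddf (R : realType) := Ddf {
  ddf_fun :> {nonneg \bar R} -> R;
  ddf_nd : {homo ddf_fun : x y / (x <= y)%O >-> x <= y};
  ddf_itv : forall x, 0 <= ddf_fun x <= 1;
  ddf0 : ddf_fun 0%:E%:nng%E = 0;
  ddfy : ddf_fun (+oo%E)%:nng%E = 1;
  ddf_left_continuous : forall x : R, 0 < x ->
    on_real ddf_fun y @[y --> x^'-] --> on_real ddf_fun x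
}.

HB.instance Definition _ (R : realType) := gen_eqMixin (ddf R).
HB.instance Definition _ (R : realType) := gen_choiceMixin (ddf R).

Definition ddf_le (R : realType) (F G : ddf R) : Prop := forall x, F x <= G x.

Lemma ddf_le_anti (R : realType) (F G : ddf R) :
  ddf_le F G -> ddf_le G F -> F = G.
Proof.
move=> FG GF; have : ddf_fun F = ddf_fun G.
  by apply/funext => x; apply/le_anti; rewrite FG GF.
case: F G {FG GF} => [f f1 f2 f3 f4 f5] [g g1 g2 g3 g4 g5] /= fg.
by subst g; congr Ddf; exact: Prop_irrelevance.
Qed.

Section epsilon.
Variables (R : realType) (a : {nonneg R}).

Let eps_fun (x : {nonneg \bar R}) : R := (a%:num%:E < x%:num)%E%:R.

Let eps_nd : {homo eps_fun : x y / (x <= y)%O >-> x <= y}.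
Proof.
move=> x y xy; rewrite /eps_fun ler_nat.
by case: (ltP a%:num%:E x%:num) => // ax; rewrite (lt_le_trans ax).
Qed.

Let eps_itv x : 0 <= eps_fun x <= 1.
Proof. by rewrite /eps_fun; case: (_ < _)%E; rewrite ?lexx ?ler01. Qed.

Let eps_at0 : eps_fun 0%:E%:nng%E = 0.
Proof. by rewrite /eps_fun/= lte_fin ltNge ge0. Qed.

Let eps_aty : eps_fun (+oo%E)%:nng%E = 1.
Proof. by rewrite /eps_fun/= ltry. Qed.

Let eps_lc (x : R) : 0 < x ->
  on_real eps_fun y @[y --> x^'-] --> on_real eps_fun x.
Proof.
move=> x0; apply: cvg_near_cst; rewrite /on_real /eps_fun/= (gtr0_norm x0).
have [ax|xa] := ltP a%:num x.
  near=> y; have ay : a%:num < y by near: y; exact: nbhs_left_gt.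
  by rewrite !lte_fin ax (lt_le_trans ay) ?ler_norm.
near=> y; have y0 : 0 < y by near: y; exact: nbhs_left_gt.
have yx : y <= x by near: y; exact: nbhs_left_le.
by rewrite !lte_fin (gtr0_norm y0) !ltNge xa (le_trans yx xa).
Unshelve. all: by end_near. Qed.

Definition eps : ddf R := Ddf eps_nd eps_itv eps_at0 eps_aty eps_lc.

End epsilon.

(* The topology of weak convergence: the sets
   [{G : |G x_i - F x_i| < e for i = 1..n}], where e > 0 and x_1, .., x_n are
   continuity points of F in ]0, +oo[, form a neighbourhood basis at F. *)
Definition continuity_point (R : realType) (F : ddf R) (x : R) : Prop :=
  0 < x /\ {for x, continuous (on_real F)}.

Definition weak_ball (R : realType) (F : ddf R) (se : seq R * R) :
    set (ddf R) :=
  [set G | {in se.1, forall x, `|on_real G x - on_real F x| < se.2}].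

Definition weak_nbhs (R : realType) (F : ddf R) : set_system (ddf R) :=
  filter_from
    [set se | 0 < se.2 /\ {in se.1, forall x, continuity_point F x}]
    (weak_ball F).

Section weak_topology.
Variable R : realType.
Implicit Types (F G H : ddf R) (A : set (ddf R)).

Lemma on_real_nd F (x y : R) : 0 <= x -> x <= y ->
  on_real F x <= on_real F y.
Proof.
move=> x0 xy; apply: ddf_nd.
suff: (`|x|%:E <= `|y|%:E)%E by [].
by rewrite lee_fin !ger0_norm// (le_trans x0).
Qed.

Lemma continuity_point_dense F (a b : R) : 0 <= a -> a < b ->
  exists2 c, a < c < b & continuity_point F c.
Proof.
move=> a0 ab; apply: contrapT => nc.
have nd : {in `[a, b] &, {homo on_real F : x y / x <= y}}.
  move=> x y; rewrite !in_itv/= => /andP[ax _] _.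
  by apply: on_real_nd; exact: le_trans ax.
have /countable_lebesgue_measure0 := discontinuity_countable nd.
suff -> : [set x | (x \in `]a, b[) /\ discontinuity (on_real F) x] = `]a, b[%classic.
  rewrite lebesgue_measure_itv/= lte_fin ab -EFinD => -[] /eqP.
  by rewrite subr_eq0 gt_eqF.
apply/seteqP; split => x /=; first by case.
rewrite in_itv/= => /andP[ax xb].
have x0 : 0 < x by exact: le_lt_trans ax.
have Fl := @ddf_left_continuous _ F _ x0.
have ar : cvg (on_real F y @[y --> x^'+]).
  apply: nondecreasing_at_right_is_cvgr.
    near=> c => y z; rewrite !in_itv/= => /andP[xy _] _; apply: on_real_nd.
    by rewrite (le_trans (ltW x0))// ltW.
  near=> c; exists (on_real F x) => _ [y /=] + <-.
  rewrite in_itv/= => /andP[xy _].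
  by apply: on_real_nd; exact: ltW.
split; first exact/andP.
split => //; first by apply/cvg_ex; exists (on_real F x).
apply/eqP; rewrite (cvg_lim _ Fl)// => Fr.
apply: nc; exists x; first exact/andP.
split=> //; apply/left_right_continuousP; split=> //.
by rewrite Fr.
Unshelve. all: by end_near. Qed.

Lemma weak_nbhs1 F (x e : R) : 0 < e -> continuity_point F x ->
  weak_nbhs F [set G | `|on_real G x - on_real F x| < e].
Proof.
move=> e0 Fx; exists ([:: x], e) => /=.
  by split=> // y; rewrite inE => /eqP ->.
by move=> G; apply; rewrite inE.
Qed.

Lemma weak_nbhs_filter F : ProperFilter (weak_nbhs F).
Proof.
apply: filter_from_proper => [|[s e] [/= e0 _]]; last first.
  by exists F => x _ /=; rewrite subrr normr0.
apply: filter_from_filter; first by exists ([::], 1).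
move=> [s e] [t d] [/= e0 sF] [/= d0 tF].
exists (s ++ t, Num.min e d) => /=.
  split; first by rewrite lt_min e0.
  by move=> x; rewrite mem_cat => /orP[/sF|/tF].
move=> G GF; split=> x xst /=.
  by have /= := GF x; rewrite mem_cat xst lt_min => /(_ isT)/andP[].
by have /= := GF x; rewrite mem_cat xst orbT lt_min => /(_ isT)/andP[].
Qed.

Lemma weak_nbhs_singleton F A : weak_nbhs F A -> A F.
Proof. by move=> [[s e] [/= e0 _]]; apply => x _; rewrite subrr normr0. Qed.

Let weak_nbhs_all F (s : seq R) (P : R -> set (ddf R)) :
  {in s, forall x, weak_nbhs F (P x)} ->
  weak_nbhs F [set G | {in s, forall x, P x G}].
Proof.
have FF := weak_nbhs_filter F.
elim: s => [_|x s ih sP]; first by apply: filterE => G /= y; rewrite in_nil.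
have {}ihs : weak_nbhs F [set G | {in s, forall x, P x G}].
  by apply: ih => y ys; apply: sP; rewrite inE ys orbT.
have Px : weak_nbhs F (P x) by apply: sP; rewrite inE eqxx.
apply: filterS (filterI Px ihs) => G [PG sG] y.
by rewrite inE => /predU1P[->//|/sG].
Qed.

Let weak_nbhs_nbhs1 F (x e : R) : 0 < e -> continuity_point F x ->
  weak_nbhs F [set G |
    weak_nbhs G [set H | `|on_real H x - on_real F x| < e]].
Proof.
move=> e0 [x0 /cvgrPdist_lt Fx].
have e3 : 0 < e / 3 by rewrite divr_gt0.
have [d /= d0 dF] := Fx _ e3.
have [x1 /andP[ax1 x1x] Fx1] : exists2 c,
    Num.max 0 (x - d) < c < x & continuity_point F c.
  by apply: continuity_point_dense; rewrite ?le_max ?lexx// gt_max x0/=; lra.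
have [x2 /andP[xx2 x2b] Fx2] : exists2 c, x < c < x + d & continuity_point F c.
  by apply: continuity_point_dense; [exact: ltW|lra].
move: ax1; rewrite gt_max => /andP[x10 ax1].
have H1 := dF x1; have H2 := dF x2.
have {}H1 : `|on_real F x - on_real F x1| < e / 3.
  by apply: H1; rewrite /ball/= gtr0_norm; lra.
have {}H2 : `|on_real F x - on_real F x2| < e / 3.
  by apply: H2; rewrite /ball/= ltr0_norm; lra.
have FF := weak_nbhs_filter F.
apply: filterS (filterI (weak_nbhs1 e3 Fx1) (weak_nbhs1 e3 Fx2)) => G /= [G1 G2].
have [y1 /andP[xy1 y1x] Gy1] := @continuity_point_dense G _ _ (ltW x10) x1x.
have [y2 /andP[xy2 y2x] Gy2] := @continuity_point_dense G _ _ (ltW x0) xx2.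
have GG := weak_nbhs_filter G.
apply: filterS (filterI (weak_nbhs1 e3 Gy1) (weak_nbhs1 e3 Gy2)) => H /= [K1 K2].
have y10 : 0 <= y1 by lra.
have := @on_real_nd H _ _ y10 (ltW y1x).
have := @on_real_nd H _ _ (ltW x0) (ltW xy2).
have := @on_real_nd G _ _ (ltW x10) (ltW xy1).
have y20 : 0 <= y2 by lra.
have := @on_real_nd G _ _ y20 (ltW y2x).
move: H1 H2 G1 G2 K1 K2; rewrite !ltr_norml.
move=> /andP[? ?] /andP[? ?] /andP[? ?] /andP[? ?] /andP[? ?] /andP[? ?] ? ? ? ?.
by apply/andP; split; lra.
Qed.

Lemma weak_nbhs_nbhs F A : weak_nbhs F A -> weak_nbhs F [set G | weak_nbhs G A].
Proof.
move=> [[s e] /= [e0 sF] sA]; have FF := weak_nbhs_filter F.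
have := @weak_nbhs_all F s _ (fun x xs => @weak_nbhs_nbhs1 F x e e0 (sF x xs)).
apply: filterS => G /weak_nbhs_all; have GG := weak_nbhs_filter G.
exact: filterS.
Qed.

HB.instance Definition _ := hasNbhs.Build (ddf R) (@weak_nbhs R).
HB.instance Definition _ := Nbhs_isNbhsTopological.Build (ddf R)
  weak_nbhs_filter weak_nbhs_singleton weak_nbhs_nbhs.

Lemma weak_cvgP (T : set_system (ddf R)) (FT : Filter T) F :
  T --> F <-> forall x, continuity_point F x ->
    on_real G x @[G --> T] --> on_real F x.
Proof.
split=> [TF x Fx|TF A].
  apply/cvgrPdist_lt => e e0; apply: TF.
  have := weak_nbhs1 e0 Fx; apply: (@filterS _ _ (weak_nbhs_filter F)) => G /=.
  by rewrite distrC.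
move=> [[s e] /= [e0 sF] sA]; apply: filterS sA _.
rewrite /weak_ball/=.
elim: s sF => [_|x s ih sF]; first by apply: filterE => G y; rewrite in_nil.
have {}ih : T [set G | {in s, forall x, `|on_real G x - on_real F x| < e}].
  by apply: ih => y ys; apply: sF; rewrite inE ys orbT.
have Tx : T [set G | `|on_real F x - on_real G x| < e].
  have /TF/cvgrPdist_lt : continuity_point F x by apply: sF; rewrite inE eqxx.
  exact.
apply: filterS (filterI Tx ih) => G [Gx sG] y.
by rewrite inE => /predU1P[->|/sG//]; rewrite distrC.
Qed.

End weak_topology.

Record triangle_function (R : realType) (tau : ddf R -> ddf R -> ddf R) :
    Prop := TriangleFunction {
  tf_comm : commutative tau;
  tf_assoc : associative tau;
  tf_ndl : forall G, {homo tau^~ G : F F' / ddf_le F F'};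
  tf_ndr : forall F, {homo tau F : G G' / ddf_le G G'};
  tf_idl : left_id (eps 0%:nng) tau;
  tf_idr : right_id (eps 0%:nng) tau
}.

Definition tf_continuous (R : realType) (tau : ddf R -> ddf R -> ddf R) :
    Prop :=
  continuous (fun FG : ddf R * ddf R => tau FG.1 FG.2).

Definition dominates (R : realType) (sigma1 sigma2 : ddf R -> ddf R -> ddf R) :
    Prop :=
  forall F1 F2 G1 G2 : ddf R,
    ddf_le (sigma2 (sigma1 F1 F2) (sigma1 G1 G2))
           (sigma1 (sigma2 F1 G1) (sigma2 F2 G2)).

Record pn_space (R : realType) (V : lmodType R) (nu : V -> ddf R)
    (tau taus : ddf R -> ddf R -> ddf R) : Prop := PNSpace {
  pn_tau : triangle_function tau;
  pn_tau_continuous : tf_continuous tau;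
  pn_taus : triangle_function taus;
  pn_taus_continuous : tf_continuous taus;
  pn_tau_le : forall F G, ddf_le (tau F G) (taus F G);
  pn_N1 : forall p, nu p = eps 0%:nng <-> p = 0;
  pn_N2 : forall p, nu (- p) = nu p;
  pn_N3 : forall p q, ddf_le (tau (nu p) (nu q)) (nu (p + q));
  pn_N4 : forall (alpha : R) p, 0 <= alpha <= 1 ->
    ddf_le (nu p) (taus (nu (alpha *: p)) (nu ((1 - alpha) *: p)))
}.

Definition tau_product (R : realType) (V1 V2 : lmodType R)
    (tau1 : ddf R -> ddf R -> ddf R) (nu1 : V1 -> ddf R) (nu2 : V2 -> ddf R)
    (pq : V1 * V2) : ddf R :=
  tau1 (nu1 pq.1) (nu2 pq.2).

(* Main.v *)
(* The order of the ddfs has [eps 0] as greatest element, so a triangle function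
   lies below each of its arguments; this gives (N1).  The two dominations are
   exactly what moves [tau] and [taus] across [tau1] in (N3) and (N4). *)
Require Import Defs.
From mathcomp Require Import all_boot all_order all_algebra.
From mathcomp Require Import all_classical all_reals all_analysis.

Import Order.TTheory GRing.Theory Num.Theory.

Local Open Scope ring_scope.

Lemma ddf_le_trans {R : realType} {F G H : ddf R} :
  ddf_le F G -> ddf_le G H -> ddf_le F H.
Proof. by move=> FG GH x; exact: le_trans (FG x) (GH x). Qed.

(** At positive arguments [eps 0] already takes the maximal value 1, and at 0 every ddf vanishes. *)
Lemma ddf_le_eps0 (R : realType) (F : ddf R) : ddf_le F (eps 0%:nng).
Proof.
move=> x; rewrite /= /eps /=.
have [x0|x0] := ltP 0%E x%:num%E; first by case/andP: (ddf_itv F x).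
have -> : x = 0%:E%:nng%E by apply/val_inj/le_anti; rewrite /= x0 ge0e.
by rewrite ddf0.
Qed.

Lemma triangle_function_le {R : realType} {tau : ddf R -> ddf R -> ddf R}
    {F F' G G' : ddf R} : triangle_function tau ->
  ddf_le F F' -> ddf_le G G' -> ddf_le (tau F G) (tau F' G').
Proof.
move=> htau FF' GG'.
by apply: ddf_le_trans; [exact: tf_ndl FF'|exact: tf_ndr GG'].
Qed.

(** If [tau F G] is [eps 0], then [eps 0 = tau F G <= tau F (eps 0) = F], and [F] is the greatest
    element; likewise for [G]. *)
Lemma triangle_function_eq_eps0 {R : realType}
    {tau : ddf R -> ddf R -> ddf R} {F G : ddf R} : triangle_function tau ->
  tau F G = eps 0%:nng <-> F = eps 0%:nng /\ G = eps 0%:nng.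
Proof.
move=> htau; split=> [FG|[-> ->]]; last exact: tf_idl.
split; apply: ddf_le_anti; [exact: ddf_le_eps0| |exact: ddf_le_eps0|].
  by rewrite -FG -[X in ddf_le _ X](tf_idr htau); apply: tf_ndr => //;
    exact: ddf_le_eps0.
by rewrite -FG -[X in ddf_le _ X](tf_idl htau); apply: tf_ndl => //;
  exact: ddf_le_eps0.
Qed.

Theorem theorem2 (R : realType) (V1 V2 : lmodType R)
    (nu1 : V1 -> ddf R) (nu2 : V2 -> ddf R)
    (tau taus tau1 : ddf R -> ddf R -> ddf R)
    (hV1 : pn_space nu1 tau taus) (hV2 : pn_space nu2 tau taus)
    (htau1 : triangle_function tau1)
    (hdom_taus : dominates taus tau1) (hdom_tau1 : dominates tau1 tau) :
  pn_space (tau_product tau1 nu1 nu2) tau taus.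
Proof.
have [htau ctau htaus ctaus tau_le N1 N2 N3 N4] := hV1.
have [_ _ _ _ _ N1' N2' N3' N4'] := hV2.
split=> // [[p q]|[p q]|[p q] [p' q']|alpha [p q] alpha01];
  rewrite /tau_product /=.
- split=> [|[-> ->]]; last first.
    by apply/triangle_function_eq_eps0 => //; split; [exact/N1|exact/N1'].
  by case/(triangle_function_eq_eps0 htau1) => /N1 -> /N1' ->.
- by rewrite N2 N2'.
(* Domination comes first, regrouping the four values by factor; (N3) then applies inside each
   argument of [tau1]. *)
- apply: ddf_le_trans (hdom_tau1 _ _ _ _) _.
  exact: triangle_function_le.
(* Here the order is reversed: (N4) in each factor gives a [tau1] of two [taus] values, which
   domination bounds by a [taus] of two [tau1] values. *)
- apply: ddf_le_trans (hdom_taus _ _ _ _).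
  by apply: triangle_function_le => //; [exact: N4|exact: N4'].
Qed.
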